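(* Consider the DEI-NCG with cost parameter $\alpha$ and exactly $k=2$ agent types, blue and red, with nonempty agent sets $V_B$ and $V_R$ of sizes $n_B\le n_R$, and let $n=n_B+n_R$. Let $\frac{n_R}{n_R+1}<\alpha<1$. Then every pairwise stable network $G$ on $V=V_B\cup V_R$ satisfies $GS(G)\ge1-\frac2n$ and $LS(G)\ge1-\frac2n$.
   Context: A network is a finite simple undirected graph $G=(V,E)$ on the set $V=V_B\cup V_R$ (disjoint union) of agents. For $u\in V$: $\deg_G(u)$ is its degree, $f_G(u)$ is the number of neighbors of $u$ of the same type as $u$, $e_G(u)$ is the number of neighbors of $u$ whose type differs from that of $u$, and $d_G(u)=\sum_{v\in V}d_G(u,v)$ is the sum of graph distances from $u$ to all agents ($=\infty$ if $G$ is disconnected). In the DEI-NCG (network creation game with decreasing effort of integration) with parameter $\alpha>0$, the cost of agent $u$ in $G$ is $$c_G(u)=\alpha\Big(\deg_G(u)+\sum_{i=1}^{e_G(u)}\frac1i\Big)+d_G(u).$$ A network $G=(V,E)$ is pairwise stable if it is connected and (i) for every agent $u$ and every neighbor $v$ of $u$, $c_G(u)\le c_{G-uv}(u)$; and (ii) for all distinct non-adjacent agents $u,v$, $c_G(u)\le c_{G+uv}(u)$ or $c_G(v)\le c_{G+uv}(v)$. The local segregation of $G$ is $LS(G)=\frac1{|V|}\sum_{u\in V}\frac{f_G(u)}{\deg_G(u)}$ and the global segregation is $GS(G)=\frac{\sum_{u\in V}f_G(u)}{2|E|}$. *)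

(* Defs.v *)
From mathcomp Require Import all_boot all_order all_algebra.
From mathcomp Require Import boolp classical_sets constructive_ereal reals ereal.

Set Implicit Arguments.
Unset Strict Implicit.
Unset Printing Implicit Defensive.

Import Order.TTheory GRing.Theory Num.Theory.

Local Open Scope ring_scope.

(* A network on the agents V is given by its adjacency relation e, assumed
   symmetric and irreflexive; VB is the set of blue agents and its complement
   the set of red agents. *)

Section Graphs.

Variable V : finType.
Implicit Types (e : rel V) (VB : {set V}) (u v x y : V).

Definition same_pair x y u v : bool :=
  ((x == u) && (y == v)) || ((x == v) && (y == u)).

Definition add_edge e u v : rel V := fun x y => e x y || same_pair x y u v.

Definition del_edge e u v : rel V := fun x y => e x y && ~~ same_pair x y u v.

Definition edges e : {set {set V}} :=
  finset (fun A : {set V} =>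
    [exists x, [exists y, e x y && (A == [set x; y])%SET]]).

Definition degree e u : nat := #|[pred v | e u v]|.

Definition same_type VB u v : bool := (u \in VB) == (v \in VB).

Definition same_degree VB e u : nat := #|[pred v | e u v && same_type VB u v]|.

Definition cross_degree VB e u : nat :=
  #|[pred v | e u v && ~~ same_type VB u v]|.

Definition connected_graph e : Prop := forall u v, connect e u v.

End Graphs.

Section Game.

Variables (R : realType) (V : finType).
Implicit Types (alpha : R) (e : rel V) (VB : {set V}) (u v : V).

(* The infimum over the empty set is +oo, so agents in different components
   are at distance +oo. *)
Definition dist e u v : \bar R :=
  ereal_inf (fun l : \bar R =>
    exists p : seq V, [/\ path e u p, last u p = v & l = (size p)%:R%:E]).

Definition dist_cost e u : \bar R := (\sum_(v : V) dist e u v)%E.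

Definition cost alpha VB e u : \bar R :=
  ((alpha * ((degree e u)%:R
             + \sum_(1 <= i < (cross_degree VB e u).+1) i%:R^-1))%:E
   + dist_cost e u)%E.

Definition pairwise_stable alpha VB e : Prop :=
  [/\ connected_graph e,
      forall u v, e u v ->
        (cost alpha VB e u <= cost alpha VB (del_edge e u v) u)%E
    & forall u v, u != v -> ~~ e u v ->
        (cost alpha VB e u <= cost alpha VB (add_edge e u v) u)%E \/
        (cost alpha VB e v <= cost alpha VB (add_edge e u v) v)%E].

Definition local_segregation VB e : R :=
  #|V|%:R^-1 * \sum_(u : V) (same_degree VB e u)%:R / (degree e u)%:R.

Definition global_segregation VB e : R :=
  (\sum_(u : V) same_degree VB e u)%N%:R / (2 * #|edges e|)%N%:R.

End Game.

Arguments dist R {V} e u v.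
Arguments dist_cost R {V} e u.
Arguments local_segregation R {V} VB e.
Arguments global_segregation R {V} VB e.

(* Main.v *)
(* Since alpha < 1, an edge between agents of the same type pays for itself, so
   both colour classes are cliques.  An agent with two neighbours in the other
   class can drop one of them and only loses distance 1, because the whole class
   stays within distance 2 through the other neighbour; as
   alpha (1 + 1/m) > 1 for m <= n_R, this would be an improvement.  Hence the
   bichromatic edges form a matching, of size at most n_B, and both bounds are
   counting. *)
Require Import Defs.
From mathcomp Require Import all_boot all_order all_algebra.
From mathcomp Require Import boolp constructive_ereal reals ereal.
From mathcomp Require Import zify lra.

Set Implicit Arguments.
Unset Strict Implicit.
Unset Printing Implicit Defensive.

Import Order.TTheory GRing.Theory Num.Theory.

Local Open Scope ring_scope.

(** * Graph distances and their sums *)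

Section Distances.

Variables (R : realType) (V : finType).
Implicit Types (e : rel V) (u v w : V).

Lemma dist_le_path e u v p :
  path e u p -> last u p = v -> (dist R e u v <= (size p)%:R%:E)%E.
Proof. by move=> up pv; apply: ereal_inf_lbound; exists p. Qed.

Lemma dist_ge e u v (k : nat) :
  (forall p, path e u p -> last u p = v -> (k <= size p)%N) ->
  (k%:R%:E <= dist R e u v)%E.
Proof.
move=> kp; apply: le_ereal_inf_tmp => _ [p [up pv ->]].
by rewrite lee_fin ler_nat kp.
Qed.

Lemma dist_ge0 e u v : (0 <= dist R e u v)%E.
Proof. exact: (@dist_ge e u v 0). Qed.

Lemma dist_xx e u : dist R e u u = 0%E.
Proof.
by apply/eqP; rewrite eq_le dist_ge0 andbT; exact: (@dist_le_path e u u [::]).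
Qed.

Lemma dist_adj_le1 e u v : e u v -> (dist R e u v <= 1)%E.
Proof. by move=> uv; apply: (@dist_le_path e u v [:: v]); rewrite //= uv. Qed.

Lemma dist_le2 e u w v : e u w -> e w v -> (dist R e u v <= 2%:R%:E)%E.
Proof.
by move=> uw wv; apply: (@dist_le_path e u v [:: w; v]); rewrite //= uw wv.
Qed.

Lemma dist_neq_ge1 e u v : u != v -> (1 <= dist R e u v)%E.
Proof.
move=> uv; apply: (@dist_ge e u v 1) => -[|//] /= _ uv_eq.
by rewrite uv_eq eqxx in uv.
Qed.

Lemma dist_nonadj_ge2 e u v :
  u != v -> ~~ e u v -> (2%:R%:E <= dist R e u v)%E.
Proof.
move=> uv nuv; apply: dist_ge => -[|x [|//]] /=.
  by move=> _ uv_eq; rewrite uv_eq eqxx in uv.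
by rewrite andbT => ux xv; rewrite -xv ux in nuv.
Qed.

Lemma dist_subrel e e' u v :
  subrel e e' -> (dist R e' u v <= dist R e u v)%E.
Proof.
move=> ee'; apply: le_ereal_inf_tmp => _ [p [up pv ->]].
exact: dist_le_path (sub_path ee' up) pv.
Qed.

Lemma dist_cost_fin_num e u : connected_graph e -> dist_cost R e u \is a fin_num.
Proof.
move=> conn; apply/sum_fin_numP => v _ _.
have /connectP[p up pv] := conn u v.
rewrite ge0_fin_numE ?dist_ge0//.
exact: le_lt_trans (dist_le_path up (esym pv)) (ltry _).
Qed.

Lemma dist_cost_ge0 e u : (0 <= dist_cost R e u)%E.
Proof. by apply: sume_ge0 => v _; exact: dist_ge0. Qed.

(** Isolates the one agent [v] whose distance gets worse or better under an edge change. Both sides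
    are sums, since a difference of possibly infinite distance costs would be meaningless. *)
Lemma dist_cost_le_except (k l : R) e e' u v :
  (dist R e u v <= k%:E)%E -> (l%:E <= dist R e' u v)%E ->
  (forall w, w != v -> (dist R e u w <= dist R e' u w)%E) ->
  (dist_cost R e u + l%:E <= dist_cost R e' u + k%:E)%E.
Proof.
move=> dk dl dw; rewrite /dist_cost (bigD1 v)//= [in leRHS](bigD1 v)//=.
rewrite addeAC [leRHS]addeAC; apply: leeD; last exact: lee_sum.
by rewrite addeC; apply: leeD.
Qed.

End Distances.

(** * Gains from adding or deleting an edge *)

Section Stability.

Variables (R : realType) (V : finType) (VB : {set V}) (alpha : R) (e : rel V).
Hypothesis sym_e : symmetric e.

Lemma add_edgeC (u v : V) : add_edge e u v = add_edge e v u.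
Proof.
apply/funext => x; apply/funext => y.
by rewrite /add_edge /same_pair [X in _ || X]orbC.
Qed.

Lemma same_typeC (u v : V) : same_type VB u v = same_type VB v u.
Proof. exact: eq_sym. Qed.

Lemma add_edgeE (u v y : V) : u != v -> add_edge e u v u y = e u y || (y == v).
Proof. by move=> uv; rewrite /add_edge /same_pair eqxx (negPf uv) /= orbF. Qed.

Lemma del_edgeE (u v y : V) : u != v -> del_edge e u v u y = e u y && (y != v).
Proof. by move=> uv; rewrite /del_edge /same_pair eqxx (negPf uv) /= orbF. Qed.

Lemma degree_add_edge (u v : V) : u != v -> ~~ e u v ->
  degree (add_edge e u v) u = (degree e u).+1.
Proof.
move=> uv nuv; rewrite /degree (cardD1 v) inE add_edgeE// eqxx orbT add1n.
congr _.+1; apply: eq_card => y; rewrite !inE add_edgeE//.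
by case: eqVneq => //= [->|_]; rewrite ?(negPf nuv)// orbF.
Qed.

Lemma cross_degree_add_edge (u v : V) : u != v -> same_type VB u v ->
  cross_degree VB (add_edge e u v) u = cross_degree VB e u.
Proof.
move=> uv st; apply: eq_card => y; rewrite !inE add_edgeE//.
by case: eqVneq => [->|_]; rewrite ?st ?andbF ?orbF.
Qed.

Lemma degree_del_edge (u v : V) : u != v -> e u v ->
  degree e u = (degree (del_edge e u v) u).+1.
Proof.
move=> uv euv; rewrite /degree (cardD1 v) inE euv add1n.
by congr _.+1; apply: eq_card => y; rewrite !inE del_edgeE// andbC.
Qed.

Lemma cross_degree_del_edge (u v : V) : u != v -> e u v -> ~~ same_type VB u v ->
  cross_degree VB e u = (cross_degree VB (del_edge e u v) u).+1.
Proof.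
move=> uv euv st; rewrite /cross_degree (cardD1 v) inE euv st add1n.
congr _.+1; apply: eq_card => y; rewrite !inE del_edgeE//.
by rewrite andbC -!andbA; congr andb; rewrite andbC.
Qed.

(** The harmonic term is unchanged, so the edge costs [alpha], below 1, while the distance to [v]
    falls from at least 2 to 1 and no other distance grows. *)
Lemma add_same_type_edge_improves (u v : V) : alpha < 1 -> connected_graph e ->
  u != v -> ~~ e u v -> same_type VB u v ->
  (cost alpha VB (add_edge e u v) u < cost alpha VB e u)%E.
Proof.
move=> alpha1 conn uv nuv st; rewrite /cost degree_add_edge//.
rewrite cross_degree_add_edge//; set H := \sum_(1 <= i < _) _.
have sub : subrel e (add_edge e u v) by move=> x y exy; rewrite /add_edge exy.
have fin := dist_cost_fin_num R u conn.
have fin' : dist_cost R (add_edge e u v) u \is a fin_num.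
  apply: dist_cost_fin_num => x y.
  by apply: connect_sub (conn x y) => a b /sub; exact: connect1.
have : (dist_cost R (add_edge e u v) u + 2%:R%:E <= dist_cost R e u + 1%:E)%E.
  apply: (@dist_cost_le_except _ _ _ _ _ _ _ v).
  - by apply: dist_adj_le1; rewrite add_edgeE// eqxx orbT.
  - exact: dist_nonadj_ge2.
  - by move=> w _; exact: dist_subrel.
rewrite -(fineK fin) -(fineK fin') -!EFinD lee_fin lte_fin -natr1.
by nra.
Qed.

Lemma same_type_adjacent (u v : V) : alpha < 1 -> pairwise_stable alpha VB e ->
  u != v -> same_type VB u v -> e u v.
Proof.
move=> alpha1 [conn _ stable] uv st; apply/negPn/negP => nuv.
(* Stability only needs one endpoint not to gain, so a strict gain is shown at each of them. *)
have [] := stable u v uv nuv; apply/negP; rewrite -ltNge.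
  exact: add_same_type_edge_improves.
rewrite add_edgeC; apply: add_same_type_edge_improves => //.
- by rewrite eq_sym.
- by rewrite sym_e.
- by rewrite same_typeC.
Qed.

(** Own-type agents remain adjacent to [u], and the clique of [w] stays within distance 2 through
    [w], so only the distance to [v] can grow, from 1 to 2. *)
Lemma dist_cost_del_edge (u v w : V) :
  (forall x y, x != y -> same_type VB x y -> e x y) ->
  e u v -> e u w -> v != w -> ~~ same_type VB u v -> ~~ same_type VB u w ->
  (dist_cost R (del_edge e u v) u <= dist_cost R e u + 1)%E.
Proof.
move=> clique euv euw vw stv stw.
have uv : u != v by apply: contraNneq stv => ->; rewrite /same_type.
have uw : u != w by apply: contraNneq stw => ->; rewrite /same_type.
have far x : e w x -> u != x -> (dist R (del_edge e u v) u x <= 2%:R%:E)%E.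
  move=> ewx ux; apply: (@dist_le2 _ _ _ _ w).
    by rewrite del_edgeE// euw eq_sym.
  rewrite /del_edge /same_pair ewx [w == u]eq_sym (negPf uw) /=.
  by rewrite [x == u]eq_sym (negPf ux) andbF.
have cross x : ~~ same_type VB u x -> x != w -> e w x.
  move=> stx xw; apply: clique; first by rewrite eq_sym.
  by move: stw stx; rewrite /same_type; do 3 case: (_ \in _).
suff : (dist_cost R (del_edge e u v) u + 1%:E <= dist_cost R e u + 2%:R%:E)%E.
  rewrite (_ : 2%:R = 1 + 1 :> R); last by rewrite -natr1.
  by rewrite EFinD addeA leeD2rE.
apply: (@dist_cost_le_except _ _ _ _ _ _ _ v).
- by apply: far => //; exact: cross.
- exact: dist_neq_ge1.
(* Neighbours of [u] other than [v] stay neighbours; a non-neighbour was already at distance at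
   least 2 and, by the clique property, lies in the class of [w]. *)
move=> x xv; have [<-|ux] := eqVneq u x; first by rewrite !dist_xx.
have [eux|neux] := boolP (e u x).
  apply: le_trans (dist_neq_ge1 _ _ ux); apply: dist_adj_le1.
  by rewrite del_edgeE// eux.
apply: le_trans (dist_nonadj_ge2 _ ux neux); apply: far => //.
apply: cross; first by apply: contra neux; exact: clique.
by apply: contraNneq neux => ->.
Qed.

(** With m the cross degree, dropping one of two cross edges saves [alpha] (1 + 1/m) and adds at
    most 1 to the distances; m/(m+1) < [alpha] says that the saving exceeds 1. *)
Lemma cross_degree_le1 (u : V) :
  (cross_degree VB e u)%:R / ((cross_degree VB e u)%:R + 1) < alpha ->
  pairwise_stable alpha VB e ->
  (forall x y, x != y -> same_type VB x y -> e x y) ->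
  (cross_degree VB e u <= 1)%N.
Proof.
move=> alpha_lb [conn stable _] clique; rewrite leqNgt; apply/negP.
move=> /card_gt1P[v [w []]]; rewrite !inE => /andP[euv stv] /andP[euw stw] vw.
have uv : u != v by apply: contraNneq stv => ->; rewrite /same_type.
have dist_le := dist_cost_del_edge clique euv euw vw stv stw.
have fin := dist_cost_fin_num R u conn.
have fin' : dist_cost R (del_edge e u v) u \is a fin_num.
  rewrite ge0_fin_numE ?dist_cost_ge0//; apply: le_lt_trans dist_le _.
  by rewrite -(fineK fin) -EFinD ltry.
move: (stable u v euv) dist_le alpha_lb; rewrite /cost.
rewrite (degree_del_edge uv euv) (cross_degree_del_edge uv euv stv).
(* [c] is the cross degree after the deletion, so m is [c.+1] and the harmonic term saved is the
   last one, [c.+1%:R^-1]. *)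
set c := cross_degree _ _ _; rewrite big_nat_recr//=.
rewrite -(fineK fin) -(fineK fin') -!EFinD !lee_fin.
set H := \sum_(1 <= i < _) _; rewrite -natr1 => stab dist_le.
have c1_gt0 : 0 < c.+1%:R :> R by rewrite ltr0n.
rewrite ltr_pdivrMr; last lra.
have : c.+1%:R^-1 * c.+1%:R = 1 :> R by rewrite mulVf// gt_eqF.
move: c1_gt0 stab; set k : R := c.+1%:R; set q := k^-1 => k0 stab qk lt_alpha.
(* Expanded with [q * k = 1], this reads [alpha * (k + 1) <= k], against the lower bound on
   [alpha]. *)
have : (alpha * (1 + q) - 1) * k <= 0 by rewrite pmulr_lle0//; nra.
by nra.
Qed.

End Stability.

(** * Degree counts *)

Section Counting.

Variables (V : finType) (VB : {set V}) (e : rel V).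
Hypotheses (sym_e : symmetric e) (irr_e : irreflexive e).

(** Double counting of incidences: every edge is a set of exactly two agents, and the edges at [u]
    are the injective image of its neighbours under [y] to {[u], [y]}. *)
Lemma handshake : (2 * #|edges e| = \sum_(u : V) degree e u)%N.
Proof.
have card2 A : A \in edges e -> #|A| = 2.
  rewrite inE => /existsP[x /existsP[y /andP[exy /eqP->]]].
  by rewrite cards2; case: eqVneq exy => [->|//]; rewrite irr_e.
rewrite mulnC -sum_nat_const -(eq_bigr _ card2).
under eq_bigr do rewrite -sum1_card.
rewrite (exchange_big_dep predT)//=; apply: eq_bigr => u _.
rewrite sum1_card /degree -[RHS](card_in_imset (f := fun y => [set u; y]%SET)).
  apply: eq_card => A; rewrite unfold_in inE; apply/andP/imsetP.
    move=> [/existsP[x /existsP[y /andP[exy /eqP->]]]].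
    rewrite !inE => /orP[] /eqP->; first by exists y.
    by exists x; rewrite ?inE 1?sym_e// setUC.
  move=> [y]; rewrite inE => euy ->; split; last by rewrite !inE eqxx.
  by apply/existsP; exists u; apply/existsP; exists y; rewrite euy eqxx.
move=> y z; rewrite !inE => euy _ /setP/(_ y); rewrite !inE eqxx orbT.
by case: eqVneq euy => [->|_ _ /esym/eqP//]; rewrite irr_e.
Qed.

Lemma degreeE (u : V) : degree e u = (same_degree VB e u + cross_degree VB e u)%N.
Proof.
rewrite /degree -(cardID [pred v | same_type VB u v]); congr addn.
by apply: eq_card => v; rewrite !inE andbC.
Qed.

Lemma same_degree_clique (u : V) :
  (forall x y, x != y -> same_type VB x y -> e x y) ->
  same_degree VB e u = #|[pred v | same_type VB u v]|.-1.
Proof.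
move=> clique; rewrite (cardD1 u) inE {1}/same_type eqxx add1n /=.
apply: eq_card => v; rewrite !inE; have [->|vu] := eqVneq v u.
  by rewrite irr_e.
have [st|_] := boolP (same_type VB u v); last by rewrite !andbF.
by rewrite clique// eq_sym.
Qed.

Lemma degree_gt0 (u : V) : connected_graph e -> (1 < #|V|)%N ->
  (0 < degree e u)%N.
Proof.
move=> conn /card_gt1P[x [y [_ _ xy]]].
have [v uv] : exists v, u != v.
  by case: (eqVneq u x) => [->|ux]; [exists y | exists x].
have /connectP[[|w p] /=] := conn u v.
  by move=> _ vu; rewrite vu eqxx in uv.
by move=> /andP[uw _] _; apply/card_gt0P; exists w; rewrite inE.
Qed.

(** Both sums count the bichromatic edges, once from each endpoint. *)
Lemma sum_cross_degreeC :
  (\sum_(u in VB) cross_degree VB e u = \sum_(u in ~: VB) cross_degree VB e u)%N.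
Proof.
have cross_sum u : (cross_degree VB e u =
    \sum_(v | (v \in VB) != (u \in VB)) e u v)%N.
  rewrite /cross_degree -sum1_card big_mkcond [RHS]big_mkcond.
  apply: eq_bigr => v _; rewrite !inE /same_type eq_sym.
  by case: (e u v); case: (_ == _).
rewrite (eq_bigr (fun u => \sum_(v in ~: VB) (e u v : nat))%N); last first.
  move=> u uB; rewrite cross_sum uB; apply: eq_bigl => v.
  by rewrite !inE; case: (_ \in _).
rewrite exchange_big /=; apply: eq_bigr => u; rewrite inE => /negPf uB.
rewrite cross_sum uB; apply: eq_big => [v|v _]; first by case: (_ \in _).
by rewrite sym_e.
Qed.

End Counting.

(** For [c = 1] both sides are s/(s+1), for [c = 0] both are 1. The denominator [s.+1] will be the
    class size in either case, so the terms of a class add up directly. *)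
Lemma local_term_ge (R : realType) (s c : nat) : (c <= 1)%N -> (0 < s + c)%N ->
  1 - c%:R / s.+1%:R <= s%:R / (s + c)%:R :> R.
Proof.
case: c => [_|[_ _|//]].
  by rewrite addn0 mul0r subr0 => s0; rewrite divff// pnatr_eq0 -lt0n.
by rewrite addn1 lerBlDr -mulrDl natr1 divff// pnatr_eq0.
Qed.

(** * The two segregation bounds *)

Theorem corollary5p6 (R : realType) (V : finType) (VB VR : {set V})
  (hcover : VB :|: VR = [set: V]) (hdisj : [disjoint VB & VR])
  (hB : VB != set0) (hR : VR != set0) (hBR : (#|VB| <= #|VR|)%N)
  (alpha : R) (halpha0 : 0 < alpha)
  (halpha_lb : #|VR|%:R / (#|VR|%:R + 1) < alpha) (halpha_ub : alpha < 1)
  (e : rel V) (hsym : symmetric e) (hirr : irreflexive e)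
  (hstable : pairwise_stable alpha VB e) :
  1 - 2 / (#|VB| + #|VR|)%N%:R <= global_segregation R VB e /\
  1 - 2 / (#|VB| + #|VR|)%N%:R <= local_segregation R VB e.
Proof.
have VRE : VR = (~: VB)%SET.
  apply/setP => x; rewrite inE; have /setP/(_ x) := hcover; rewrite !inE.
  by case: (boolP (x \in VB)) => //= xB _; rewrite (disjointFr hdisj xB).
have cardV : #|V| = (#|VB| + #|VR|)%N by rewrite VRE cardsC.
have nB0 : (0 < #|VB|)%N by rewrite card_gt0.
have nR0 : (0 < #|VR|)%N by rewrite card_gt0.
have clique x y : x != y -> same_type VB x y -> e x y.
  by move=> xy st; apply: (same_type_adjacent hsym halpha_ub hstable).
(* Keeps the quotients away from the default value x/0 = 0. *)
have deg0 u : (0 < degree e u)%N.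
  by apply: degree_gt0; [case: hstable | rewrite cardV; lia].
have blockB u : u \in VB -> [pred v | same_type VB u v] =i VB.
  by move=> uB v; rewrite inE /same_type uB; case: (_ \in _).
have blockR u : u \in VR -> [pred v | same_type VB u v] =i VR.
  by rewrite VRE => /[!inE] /negPf uB v; rewrite !inE /same_type uB; case: (_ \in _).
have sB u : u \in VB -> same_degree VB e u = #|VB|.-1.
  by move=> uB; rewrite same_degree_clique// (eq_card (blockB u uB)).
have sR u : u \in VR -> same_degree VB e u = #|VR|.-1.
  by move=> uR; rewrite same_degree_clique// (eq_card (blockR u uR)).
have cross_le u : (cross_degree VB e u <= #|VR|)%N.
  have [uB|uB] := boolP (u \in VB); last apply: leq_trans hBR;
    apply: subset_leq_card; apply/subsetP => v; rewrite !inE => /andP[_];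
    rewrite /same_type.
    by rewrite VRE inE uB; case: (_ \in _).
  by rewrite (negPf uB); case: (_ \in _).
have cross1 u : (cross_degree VB e u <= 1)%N.
  apply: (cross_degree_le1 _ hstable clique).
  (* Since x/(x+1) is increasing, the bound on [alpha] at the size of [VR] covers every cross
     degree. *)
  apply: le_lt_trans halpha_lb; have := cross_le u; rewrite -(ler_nat R).
  have := ler0n R (cross_degree VB e u).
  set c : R := _%:R; set k : R := _%:R => c0 ck.
  rewrite ler_pdivrMr; last lra.
  by rewrite mulrAC ler_pdivlMr; [nra | lra].
have splitV (T : nmodType) (F : V -> T) :
    \sum_u F u = \sum_(u in VB) F u + \sum_(u in VR) F u.
  rewrite (bigID (mem VB))/=; congr (_ + _); apply: eq_bigl => u.
  by rewrite VRE inE.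
(* [m] is the number of bichromatic edges. *)
pose m := (\sum_(u in VB) cross_degree VB e u)%N.
have mR : (\sum_(u in VR) cross_degree VB e u = m)%N.
  by rewrite VRE /m sum_cross_degreeC.
have m_le : (m <= #|VB|)%N by rewrite -sum1_card; apply: leq_sum.
have nB1R : 1 <= #|VB|%:R :> R by rewrite ler1n.
have nBRR : #|VB|%:R <= #|VR|%:R :> R by rewrite ler_nat.
have m_leR : m%:R <= #|VB|%:R :> R by rewrite ler_nat.
have m0R := ler0n R m.
have predB : #|VB|.-1%:R = #|VB|%:R - 1 :> R by rewrite -subn1 natrB.
have predR : #|VR|.-1%:R = #|VR|%:R - 1 :> R by rewrite -subn1 natrB.
have n0R : 0 < (#|VB| + #|VR|)%:R :> R by rewrite ltr0n addn_gt0 nB0.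
split.
- rewrite /global_segregation handshake//.
  have sumS : (\sum_u same_degree VB e u =
      #|VB| * #|VB|.-1 + #|VR| * #|VR|.-1)%N.
    rewrite [LHS]splitV (eq_bigr _ sB) [X in (_ + X)%R](eq_bigr _ sR).
    by rewrite !sum_nat_const.
  have sumC : (\sum_u cross_degree VB e u = m + m)%N by rewrite [LHS]splitV mR.
  have sumD : (\sum_u degree e u = #|VB| * #|VB|.-1 + #|VR| * #|VR|.-1 + (m + m))%N.
    by rewrite (eq_bigr _ (fun u _ => degreeE VB e u)) big_split /= sumS sumC.
  have sumD0 : 0 < (\sum_u degree e u)%N%:R :> R.
    have [x xB] := set0Pn _ hB.
    by rewrite ltr0n (bigD1 x)//= addn_gt0 deg0.
  rewrite ler_pdivlMr// sumS sumD.
  rewrite -(ler_pM2r n0R) mulrAC mulrBl divfK ?gt_eqF// mul1r.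
  rewrite !natrD !natrM predB predR.
  move: #|VB|%:R #|VR|%:R m%:R nB1R nBRR m_leR m0R => b r x b1 br xb x0.
  (* The goal amounts to (b + r - 2) x <= b(b-1) + r(r-1), and the difference of the two sides is
     exactly (r-b)(r-1) + (b-x)(b+r-2). *)
  have : 0 <= (r - b) * (r - 1) by apply: mulr_ge0; lra.
  have : 0 <= (b - x) * (b + r - 2) by apply: mulr_ge0; lra.
  by nra.
- rewrite /local_segregation cardV ler_pdivlMl// mulrBr mulr1.
  rewrite mulrCA divff ?gt_eqF// mulr1.
  have term u : 1 - (cross_degree VB e u)%:R / (same_degree VB e u).+1%:R <=
      (same_degree VB e u)%:R / (degree e u)%:R :> R.
    by rewrite (degreeE VB) local_term_ge// -degreeE.
  apply: le_trans (ler_sum _ (fun u _ => term u)).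
  rewrite splitV.
  have sum_block (A : {set V}) : (0 < #|A|)%N ->
      (forall u, u \in A -> same_degree VB e u = #|A|.-1) ->
      \sum_(u in A) (1 - (cross_degree VB e u)%:R / (same_degree VB e u).+1%:R) =
      #|A|%:R - (\sum_(u in A) cross_degree VB e u)%N%:R / #|A|%:R :> R.
    move=> A0 sA; rewrite natr_sum mulr_suml -[X in X%:R - _]sum1_card.
    rewrite natr_sum -sumrB.
    by apply: eq_bigr => u uA; rewrite sA// prednK.
  rewrite !sum_block// mR -/m natrD.
  (* Each class loses [m] divided by its size, hence at most 1, so the total loss is at most 2. *)
  have : m%:R / #|VB|%:R <= 1 :> R by rewrite ler_pdivrMr ?mul1r; lra.
  have : m%:R / #|VR|%:R <= 1 :> R by rewrite ler_pdivrMr ?mul1r; lra.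
  by lra.
Qed.
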